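(* Let $p\ge 2$ be a prime, let $m,n,r>0$ be natural numbers, and let $s\geq 1$ be a natural number. Let $\tau=\{T[k] : k\in\mathcal K\}$ be the set of all generalized Rijndael-like round functions on $M_{m,n}(\mathrm{GF}(p^r))$, let $\mathcal G_\tau=\langle T[k] : k\in\mathcal K\rangle$, and let $\mathcal G_\tau^s=\langle T[k_s]T[k_{s-1}]\cdots T[k_1] : k_i\in\mathcal K\rangle$. Denote by $\mathcal A_{p^{rmn}}$ and $\mathcal S_{p^{rmn}}$ the alternating and symmetric groups on the set $M_{m,n}(\mathrm{GF}(p^r))$. Then: (a) If $\mathcal G_\tau=\mathcal A_{p^{rmn}}$, then $\mathcal G_\tau^s=\mathcal A_{p^{rmn}}$. (b) If $\mathcal G_\tau=\mathcal S_{p^{rmn}}$, then $\mathcal G_\tau^s=\mathcal A_{p^{rmn}}$ if $s$ is even and $\mathcal G_\tau^s=\mathcal S_{p^{rmn}}$ if $s$ is odd.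
   Context: $M_{m,n}(\mathrm{GF}(p^r))$ is the set of $m\times n$ matrices over $\mathrm{GF}(p^r)$, with rows indexed by $0\le i<m$ and columns by $0\le j<n$. Component functions (all permutations of $M_{m,n}(\mathrm{GF}(p^r))$): - For $k\in M_{m,n}(\mathrm{GF}(p^r))$, $\sigma[k](a)=a+k$ (entrywise addition). - $\lambda$ applies to every entry the same S-box: $\lambda(a)_{ij}=A\,a_{ij}^{-1}+B$ if $a_{ij}\ne 0$ and $\lambda(a)_{ij}=B$ if $a_{ij}=0$, where $A,B\in\mathrm{GF}(p^r)$ are fixed and $A\neq 0$ (so that the S-box is bijective). - $\pi$ is given by $\pi(a)_{ij}=a_{i,(j-c(i)) \bmod n}$, where $c:\{0,\dots,m-1\}\to\{0,\dots,n-1\}$ is a fixed map. - $\rho$ multiplies each column by a fixed invertible matrix $C\in M_{m,m}(\mathrm{GF}(p^r))$ (the ''diffusion matrix''), i.e. $\rho(a)=C a$. The generalized Rijndael-like round function is $T[k]=\sigma[k]\circ\rho\circ\pi\circ\lambda$, where $k$ ranges over the set of round keys $\mathcal K=M_{m,n}(\mathrm{GF}(p^r))$ (the functions $\lambda,\pi,\rho$ being fixed). Products of round functions denote composition; in $\mathcal G_\tau^s$ the round keys $k_1,\dots,k_s$ are chosen independently.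
   Formalization: The formal theorem excludes two degenerate cases where the claim fails: in (a), p^{rmn} = 4 with 3 dividing s (then the s-fold group is the Klein four-group), and in (b) for even s, p^{rmn} = 2 (then the s-fold group is S_2, not A_2). *)

(* Defs.v *)
From HB Require Import structures.
From mathcomp Require Import all_boot all_order all_algebra all_fingroup.
From mathcomp Require Import all_solvable.

Set Implicit Arguments.
Unset Strict Implicit.
Unset Printing Implicit Defensive.

Import GRing.Theory.
Local Open Scope ring_scope.

Definition sigma_fun (F : finFieldType) (m n : nat) (k a : 'M[F]_(m, n)) :
  'M[F]_(m, n) := a + k.

Definition sbox (F : finFieldType) (A B x : F) : F :=
  if x == 0 then B else A * x^-1 + B.

Definition lambda_fun (F : finFieldType) (m n : nat) (A B : F)
  (a : 'M[F]_(m, n)) : 'M[F]_(m, n) := map_mx (sbox A B) a.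

Lemma ord_subm_proof (n : nat) (j d : 'I_n) : ((j + (n - d)) %% n < n)%N.
Proof. exact: ltn_pmod (leq_ltn_trans (leq0n j) (ltn_ord j)). Qed.

(* (j - d) mod n; since d < n, adding n before subtracting avoids the
   truncation of the subtraction on nat. *)
Definition ord_subm (n : nat) (j d : 'I_n) : 'I_n :=
  Ordinal (ord_subm_proof j d).

Definition pi_fun (F : finFieldType) (m n : nat) (c : 'I_m -> 'I_n)
  (a : 'M[F]_(m, n)) : 'M[F]_(m, n) := \matrix_(i, j) a i (ord_subm j (c i)).

Definition rho_fun (F : finFieldType) (m n : nat) (C : 'M[F]_m)
  (a : 'M[F]_(m, n)) : 'M[F]_(m, n) := C *m a.

Definition round_fun (F : finFieldType) (m n : nat) (A B : F)
  (c : 'I_m -> 'I_n) (C : 'M[F]_m) (k : 'M[F]_(m, n)) :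
  'M[F]_(m, n) -> 'M[F]_(m, n) :=
  sigma_fun k \o rho_fun C \o pi_fun c \o lambda_fun A B.

Lemma sigma_fun_inj (F : finFieldType) (m n : nat) (k : 'M[F]_(m, n)) :
  injective (sigma_fun k).
Proof. exact: addIr. Qed.

Lemma sbox_inj (F : finFieldType) (A B : F) : A != 0 -> injective (sbox A B).
Proof.
move=> A0; have E x : sbox A B x = A * x^-1 + B.
  by rewrite /sbox; case: eqP => // ->; rewrite invr0 mulr0 add0r.
by move=> x y; rewrite !E => /addIr/(mulfI A0)/invr_inj.
Qed.

Lemma lambda_fun_inj (F : finFieldType) (m n : nat) (A B : F) :
  A != 0 -> injective (@lambda_fun F m n A B).
Proof.
move=> A0 a b /matrixP ab; apply/matrixP => i j.
by apply: (sbox_inj (B := B) A0); have := ab i j; rewrite !mxE.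
Qed.

Lemma ord_submE (n : nat) (j d : 'I_n) :
  (ord_subm j d + d)%N = j %[mod n].
Proof.
by rewrite /= modnDml -addnA subnK ?modnDr // ltnW.
Qed.

Lemma ord_subm_bij (n : nat) (d : 'I_n) : bijective (fun j => ord_subm j d).
Proof.
apply: injF_bij => j j' /(congr1 (fun x : 'I_n => (x + d)%N %% n)%N) e.
by apply: val_inj; move: e; rewrite !ord_submE !modn_small.
Qed.

Lemma pi_fun_inj (F : finFieldType) (m n : nat) (c : 'I_m -> 'I_n) :
  injective (@pi_fun F m n c).
Proof.
move=> a b /matrixP ab; apply/matrixP => i j.
have [g _ gK] := ord_subm_bij (c i).
by have := ab i (g j); rewrite !mxE gK.
Qed.

Lemma rho_fun_inj (F : finFieldType) (m n : nat) (C : 'M[F]_m) :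
  C \in unitmx -> injective (@rho_fun F m n C).
Proof. by move=> uC; apply: can_inj (mulKmx uC). Qed.

Lemma round_fun_inj (F : finFieldType) (m n : nat) (A B : F)
  (c : 'I_m -> 'I_n) (C : 'M[F]_m) (k : 'M[F]_(m, n)) :
  A != 0 -> C \in unitmx -> injective (round_fun A B c C k).
Proof.
move=> A0 uC; apply: inj_comp; last exact: lambda_fun_inj.
apply: inj_comp; last exact: pi_fun_inj.
by apply: inj_comp; [apply: sigma_fun_inj | apply: rho_fun_inj].
Qed.

Definition round (F : finFieldType) (m n : nat) (A B : F) (c : 'I_m -> 'I_n)
  (C : 'M[F]_m) (hA : A != 0) (hC : C \in unitmx) (k : 'M[F]_(m, n)) :
  {perm 'M[F]_(m, n)} := perm (@round_fun_inj F m n A B c C k hA hC).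

Definition round_group (F : finFieldType) (m n : nat) (A B : F)
  (c : 'I_m -> 'I_n) (C : 'M[F]_m) (hA : A != 0) (hC : C \in unitmx) :
  {set {perm 'M[F]_(m, n)}} :=
  <<[set round B c hA hC k | k : 'M[F]_(m, n)]>>%g.

(* The product of {perm _} applies its left factor first, so the product of
   the T[k i] for i = 0, ..., s - 1 is the map T[k (s - 1)] \o ... \o T[k 0]. *)
Definition multiround (F : finFieldType) (m n : nat) (A B : F)
  (c : 'I_m -> 'I_n) (C : 'M[F]_m) (hA : A != 0) (hC : C \in unitmx)
  (s : nat) (k : {ffun 'I_s -> 'M[F]_(m, n)}) : {perm 'M[F]_(m, n)} :=
  (\prod_(i < s) round B c hA hC (k i))%g.

Definition multiround_group (F : finFieldType) (m n : nat) (A B : F)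
  (c : 'I_m -> 'I_n) (C : 'M[F]_m) (hA : A != 0) (hC : C \in unitmx)
  (s : nat) : {set {perm 'M[F]_(m, n)}} :=
  <<[set multiround B c hA hC k | k : {ffun 'I_s -> 'M[F]_(m, n)}]>>%g.

(* Main.v *)
Require Import Defs.
From HB Require Import structures.
From mathcomp Require Import all_boot all_order all_algebra all_fingroup.
From mathcomp Require Import all_solvable.
From mathcomp Require Import finfield zify.

Set Implicit Arguments.
Unset Strict Implicit.
Unset Printing Implicit Defensive.

Import GRing.Theory.
Local Open Scope ring_scope.

(** Let [X] be the set of rounds, [G] the group it generates and [H] the group
    generated by the words of length [s] in [X]. Two words of length [s] that
    differ in one end letter only show that [H] contains all ratios of letters.
    Two consequences hold for any set of generators: [H] is normal in [G]
    (words_normal), and all letters agree modulo [H], so that [G / H] is cyclic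
    (words_quotient_cycle), of order dividing [s] since a word of length [s] is
    trivial in it (words_index_dvdn). For rounds, the ratios of letters include
    all the translations of the state space, because the round key is added
    last; in particular [H] is transitive.

    If [G] is the alternating group on [N >= 5] points, it is simple and [H] is
    a nontrivial normal subgroup, so [H = G]. If [N <= 4], then [N] divides the
    order of [H], and comparing with [N! / 2] shows that the index of [H] is 1,
    or possibly 3 when [N = 4]; this last case is impossible when 3 does not
    divide [s].

    If [G] is the symmetric group, [G / H] is abelian and [H] contains the
    derived group of [G], hence the alternating group (Alt_sub_der1_Sym). So
    the index of [H] is 1 or 2. For [s] odd it is 1, since it divides [s]. For
    [s] even, a translation is an even permutation as soon as [N] is not 2
    (translation_even), so that all rounds have the same parity and words of
    even length are even: [H] is the alternating group. *)

(** * Groups generated by the words of a fixed length *)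

Lemma mem_expsg (gT : finGroupType) (X : {set gT}) (x : gT) (n : nat) :
  x \in X -> (x ^+ n)%g \in (X ^+ n)%g.
Proof.
by move=> Xx; elim: n => [|n IHn]; rewrite ?expg0 ?set11 // !expgS mem_mulg.
Qed.

(** Append the same word of length [s - 1] to both letters: it cancels in the
    ratio of the two words of length [s] so obtained. *)
Lemma letter_ratio_in_words (gT : finGroupType) (X : {set gT}) (s : nat)
  (x y : gT) :
  (0 < s)%N -> x \in X -> y \in X -> (x * y^-1)%g \in <<X ^+ s>>%g.
Proof.
case: s => // s _ Xx Xy; have Xu := mem_expsg s Xx.
have -> : (x * y^-1 = (x * x ^+ s) * (y * x ^+ s)^-1)%g.
  by rewrite invMg mulgA mulgK.
by rewrite groupM ?groupV // mem_gen // expgS mem_mulg.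
Qed.

(** Here the common word is put in front of the letters. *)
Lemma letter_ratio_in_wordsV (gT : finGroupType) (X : {set gT}) (s : nat)
  (x y : gT) :
  (0 < s)%N -> x \in X -> y \in X -> (x^-1 * y)%g \in <<X ^+ s>>%g.
Proof.
case: s => // s _ Xx Xy; have Xu := mem_expsg s Xx.
have -> : (x^-1 * y = (x ^+ s * x)^-1 * (x ^+ s * y))%g.
  by rewrite invMg mulgA mulgKV.
by rewrite groupM ?groupV // mem_gen // expgSr mem_mulg.
Qed.

(** Conjugating a word [y * w] by a letter [x] gives
    [(x^-1 * y) * (w * x)]: a ratio of letters times another word of the same
    length. *)
Lemma words_normal (gT : finGroupType) (X : {set gT}) (s : nat) :
  (0 < s)%N -> (<<X ^+ s>> <| <<X>>)%g.
Proof.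
move=> s_gt0; apply/andP; split.
  rewrite gen_subG; elim: s {s_gt0} => [|s IHs]; first by rewrite expg0 sub1G.
  by rewrite expgS mul_subG // subset_gen.
rewrite gen_subG; apply/subsetP => x Xx; rewrite inE -genJ gen_subG.
apply/subsetP => _ /imsetP[w Xw ->]; case: s s_gt0 Xw => // s _.
rewrite {1}expgS => /mulsgP[y u Xy Xu ->].
have -> : ((y * u) ^ x = x^-1 * y * (u * x))%g by rewrite conjgE !mulgA.
apply: groupM; first exact: letter_ratio_in_wordsV.
by rewrite mem_gen // expgSr mem_mulg.
Qed.

(** Modulo the group of words, all the letters coincide, since the ratio of
    two letters is in it. *)
Lemma words_quotient_cycle (gT : finGroupType) (X : {set gT}) (s : nat)
  (x : gT) :
  (0 < s)%N -> x \in X ->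
  (<<X>> / <<X ^+ s>> = <[coset <<X ^+ s>> x]>)%g.
Proof.
move=> s_gt0 Xx; have /andP[_ nHG] := words_normal X s_gt0.
have nHX : (X \subset 'N(<<X ^+ s>>))%g := subset_trans (subset_gen X) nHG.
rewrite quotient_gen //; congr (<<_>>)%g; apply/setP => u; rewrite inE.
apply/idP/eqP => [/morphimP[y nHy Xy ->] | ->].
  by apply/rcoset_kercosetP; rewrite ?(subsetP nHX) // mem_rcoset
    letter_ratio_in_words.
by rewrite mem_morphim ?(subsetP nHX).
Qed.

Lemma words_quotient_abelian (gT : finGroupType) (X : {set gT}) (s : nat)
  (x : gT) :
  (0 < s)%N -> x \in X -> abelian (<<X>> / <<X ^+ s>>)%g.
Proof. by move=> s0 Xx; rewrite (words_quotient_cycle s0 Xx) cycle_abelian. Qed.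

(** The generator of the cyclic quotient is the class of a letter, whose
    [s]-th power is itself a word of length [s]. *)
Lemma words_index_dvdn (gT : finGroupType) (X : {set gT}) (s : nat) (x : gT) :
  (0 < s)%N -> x \in X -> (#|<<X>> : <<X ^+ s>>|%g %| s)%N.
Proof.
move=> s0 Xx; have /andP[_ nHG] := words_normal X s0.
have nHx : x \in ('N(<<X ^+ s>>))%g by rewrite (subsetP nHG) ?mem_gen.
rewrite -card_quotient // (words_quotient_cycle s0 Xx).
rewrite -orderE order_dvdn -morphX //.
by apply/eqP/coset_id; rewrite mem_gen // mem_expsg.
Qed.

(** * Parity of permutations *)

(** All transpositions are conjugate, so a product of two of them is a
    commutator; an even permutation is a product of such pairs. *)
Lemma Alt_sub_der1_Sym (T : finType) : ('Alt_T)%g \subset (('Sym_T)^`(1))%g.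
Proof.
pose D := (('Sym_T)^`(1))%g.
have pairD (t u : T * T) : dpair t -> dpair u ->
    (tperm t.1 t.2 * tperm u.1 u.2)%g \in D.
  case: t u => a b [c d]; rewrite /dpair /= => ab cd.
  (* The first factor of g sends a to c, which differs from d and from the
     image of b; hence the second factor fixes it. *)
  pose g := (tperm a c * tperm (tperm a c b) d)%g.
  have ga : g a = c.
    rewrite permM tpermL tpermD // 1?eq_sym //.
    by rewrite -{1}(tpermL a c) (inj_eq perm_inj).
  have gb : g b = d by rewrite permM tpermL.
  have -> : tperm c d = (tperm a b ^ g)%g by rewrite tpermJ ga gb.
  rewrite -{1}tpermV -commgEl; apply: mem_commg; exact: in_setT.
apply/subsetP => s; rewrite Alt_even.
have [ts -> dts] := prod_tpermP s; rewrite odd_perm_prod // => ets.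
have [n] := ubnP (size ts); elim: n ts dts ets => // n IHn.
case=> [|t [|u ts]] //=; first by rewrite big_nil group1.
case/and3P=> dt du dts; rewrite negbK => ets szts.
rewrite !big_cons mulgA groupM ?pairD //; apply: IHn => //.
by rewrite ltnS in szts; apply: leq_trans szts; rewrite ltnS leqnSn.
Qed.

(** The cycles of a fixed point free involution are transpositions, and there
    are half as many of them as points. *)
Lemma odd_fixfree_involution (T : finType) (s : {perm T}) :
  (s ^+ 2 = 1)%g -> (forall x, s x != x) -> s = odd #|T|./2 :> bool.
Proof.
move=> s2 sfix.
have ss x : s (s x) = x by rewrite -permM -expg2 s2 perm1.
have card_cycle (A : {set T}) : A \in porbits s -> #|A| = 2%N.
  case/imsetP => x _ ->.
  suff -> : porbit s x = [set x; s x] by rewrite cards2 eq_sym sfix.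
  apply/setP => y; rewrite !inE; apply/porbitP/orP => [[i ->] | [] /eqP->].
  - elim: i => [|i IHi]; first by left; rewrite expg0 perm1.
    rewrite expgSr permM; case: IHi => /eqP ->; first by right.
    by left; rewrite ss.
  - by exists 0; rewrite expg0 perm1.
  - by exists 1%N; rewrite expg1.
have porbits_partition : partition (porbits s) [set: T].
  have -> : porbits s = [set orbit 'P <[s]> x | x in [set: T]]%g.
    apply/setP => A; apply/imsetP/imsetP => -[x _ ->]; exists x;
      by rewrite ?in_setT ?porbitE.
  apply: orbit_partition; apply/subsetP => a _; rewrite !inE.
  by apply/subsetP => x; rewrite !inE.
have := card_uniform_partition card_cycle porbits_partition.
by rewrite cardsT /odd_perm => ->; rewrite oddM andbF muln2 doubleK.
Qed.

(** * Translations *)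

Definition translation (V : finZmodType) (k : V) : {perm V} :=
  perm (@addIr V k).

Lemma translationX (V : finZmodType) (k x : V) (n : nat) :
  (translation k ^+ n)%g x = x + k *+ n.
Proof.
elim: n => [|n IHn]; first by rewrite expg0 perm1 mulr0n addr0.
by rewrite expgSr permM IHn permE mulrSr addrA.
Qed.

(** A translation of odd order is even because a power of it of odd exponent
    is trivial. In characteristic 2 a nontrivial one is a product of [#|V| / 2]
    disjoint transpositions, an even number as soon as 4 divides [#|V|]. *)
Lemma translation_even (V : finZmodType) (p e : nat) (k : V) :
  prime p -> #|V| = (p ^ e)%N -> #|V| <> 2%N -> k *+ p = 0 ->
  translation k = false :> bool.
Proof.
move=> pr_p cV V2 kp.
have tp : (translation k ^+ p = 1)%g.
  by apply/permP => x; rewrite translationX kp addr0 perm1.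
have [p2 | odd_p] := even_prime pr_p; last first.
  have oddX (t : {perm V}) i : (t ^+ i)%g = odd i && t :> bool.
    elim: i => [|i IHi]; first by rewrite expg0 odd_perm1.
    by rewrite expgS odd_permM IHi /=; case: (odd i); case: (odd_perm t).
  by have := congr1 (@odd_perm V) tp; rewrite oddX odd_p odd_perm1.
have [-> | k0] := eqVneq k 0.
  suff -> : translation (0 : V) = 1%g by rewrite odd_perm1.
  by apply/permP => x; rewrite permE perm1 addr0.
rewrite odd_fixfree_involution; last 2 first.
- by rewrite -{1}p2.
- by move=> x; rewrite permE -subr_eq0 addrAC subrr add0r.
move: V2; rewrite {}cV {}p2; case: e => [|[|e]] // _.
by rewrite expnS mul2n doubleK oddX.
Qed.

(** * Rounds and words of rounds *)

Definition rounds (F : finFieldType) (m n : nat) (A B : F) (c : 'I_m -> 'I_n)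
  (C : 'M[F]_m) (hA : A != 0) (hC : C \in unitmx) : {set {perm 'M[F]_(m, n)}} :=
  [set round B c hA hC k | k : 'M[F]_(m, n)].

Lemma mem_rounds (F : finFieldType) (m n : nat) (A B : F) (c : 'I_m -> 'I_n)
  (C : 'M[F]_m) (hA : A != 0) (hC : C \in unitmx) (k : 'M[F]_(m, n)) :
  round B c hA hC k \in rounds B c hA hC.
Proof. exact: imset_f. Qed.

(** The round keys being independent, the [s]-fold rounds are exactly the
    words of length [s] in the rounds. *)
Lemma multiround_groupE (F : finFieldType) (m n : nat) (A B : F)
  (c : 'I_m -> 'I_n) (C : 'M[F]_m) (hA : A != 0) (hC : C \in unitmx)
  (s : nat) :
  multiround_group B c hA hC s = <<rounds B c hA hC ^+ s>>%g.
Proof.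
congr (<<_>>)%g.
have -> : (rounds B c hA hC ^+ s = \prod_(i < s) rounds B c hA hC)%g.
  by rewrite big_const card_ord; elim: s => //= s <-; rewrite expgS.
apply/setP => g; apply/imsetP/prodsgP => [[k _ ->] | [w Xw ->]].
  by exists (fun i => round B c hA hC (k i)) => // i _; apply: mem_rounds.
have Hw i : exists k, w i == round B c hA hC k.
  by have /imsetP[k _ ->] := Xw i isT; exists k.
exists [ffun i => xchoose (Hw i)] => //.
by apply: eq_bigr => i _; rewrite ffunE; apply/eqP/(xchooseP (Hw i)).
Qed.

Lemma round_translation (F : finFieldType) (m n : nat) (A B : F)
  (c : 'I_m -> 'I_n) (C : 'M[F]_m) (hA : A != 0) (hC : C \in unitmx)
  (k : 'M[F]_(m, n)) :
  round B c hA hC k = (round B c hA hC 0 * translation k)%g.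
Proof.
apply/permP => a.
by rewrite permM !permE /round_fun /= /sigma_fun addr0.
Qed.

(** A translation is a ratio of two rounds, that is, of two letters. *)
Lemma translation_in_words (F : finFieldType) (m n : nat) (A B : F)
  (c : 'I_m -> 'I_n) (C : 'M[F]_m) (hA : A != 0) (hC : C \in unitmx)
  (s : nat) (k : 'M[F]_(m, n)) :
  (0 < s)%N -> translation k \in <<rounds B c hA hC ^+ s>>%g.
Proof.
move=> s0; rewrite -(mulKg (round B c hA hC 0) (translation k)).
by rewrite -round_translation letter_ratio_in_wordsV // mem_rounds.
Qed.

(** The group of words is transitive because it contains the translations. *)
Lemma card_dvdn_words (F : finFieldType) (m n : nat) (A B : F)
  (c : 'I_m -> 'I_n) (C : 'M[F]_m) (hA : A != 0) (hC : C \in unitmx)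
  (s : nat) :
  (0 < s)%N ->
  (#|{: 'M[F]_(m, n)}| %| #|<<rounds B c hA hC ^+ s>>%g|)%N.
Proof.
move=> s0; rewrite -cardsT; apply: (@atrans_dvd _ _ 'P%act).
apply/imsetP; exists 0; first exact: in_setT.
apply/esym/eqP; rewrite -subTset; apply/subsetP => x _; apply/orbitP.
exists (translation x); first exact: translation_in_words.
by rewrite /= /aperm permE add0r.
Qed.

(** All the rounds have the same parity when the translations are even, so an
    even number of them composes to an even permutation. *)
Lemma words_even (F : finFieldType) (m n : nat) (A B : F)
  (c : 'I_m -> 'I_n) (C : 'M[F]_m) (hA : A != 0) (hC : C \in unitmx)
  (s : nat) :
  (forall k : 'M[F]_(m, n), translation k = false :> bool) -> ~~ odd s ->
  (<<rounds B c hA hC ^+ s>> \subset 'Alt_('M[F]_(m, n)))%g.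
Proof.
move=> t_even /negbTE es; rewrite gen_subG; apply/subsetP => g Xg.
suff: g = odd s && round B c hA hC 0 :> bool by rewrite Alt_even es => ->.
elim: s g Xg {es} => [|s IHs] g.
  by rewrite expg0 inE => /eqP->; exact: odd_perm1.
rewrite expgS => /mulsgP[_ u /imsetP[k _ ->] Xu ->].
rewrite odd_permM (IHs u Xu) (round_translation _ _ _ _ k) odd_permM t_even addbF /=.
by case: (odd s); case: (odd_perm _).
Qed.

(** * Alternating and symmetric round groups *)

Theorem theorem40 (p m n r s : nat) (F : finFieldType)
  (hp : prime p) (hm : (0 < m)%N) (hn : (0 < n)%N) (hr : (0 < r)%N)
  (hs : (1 <= s)%N) (hF : #|F| = (p ^ r)%N)
  (A B : F) (hA : A != 0) (c : 'I_m -> 'I_n)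
  (C : 'M[F]_m) (hC : C \in unitmx) :
  (round_group B c hA hC = ('Alt_('M[F]_(m, n)))%g ->
     ((p ^ (r * m * n))%N = 4%N -> ~~ (3 %| s)%N) ->
     multiround_group B c hA hC s = ('Alt_('M[F]_(m, n)))%g)
  /\
  (round_group B c hA hC = ('Sym_('M[F]_(m, n)))%g ->
     (~~ odd s -> (p ^ (r * m * n))%N <> 2%N ->
        multiround_group B c hA hC s = ('Alt_('M[F]_(m, n)))%g)
     /\
     (odd s -> multiround_group B c hA hC s = ('Sym_('M[F]_(m, n)))%g)).
Proof.
have e_gt0 : (0 < r * m * n)%N by rewrite !muln_gt0 hr hm.
have cardM : #|{: 'M[F]_(m, n)}| = (p ^ (r * m * n))%N.
  by rewrite card_mx hF -expnM mulnA.
have M_gt1 : (1 < #|{: 'M[F]_(m, n)}|)%N.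
  by rewrite cardM -(exp1n (r * m * n)) ltn_exp2r // prime_gt1.
rewrite -cardM multiround_groupE /round_group -/(rounds B c hA hC).
set X := rounds B c hA hC; set H := <<X ^+ s>>%G; rewrite -[<<X ^+ s>>%g]/(gval H).
have X0 : round B c hA hC 0 \in X := mem_rounds _ _ _ _ _.
have := words_normal X hs; have := words_index_dvdn hs X0.
have := words_quotient_abelian hs X0; rewrite -[<<X ^+ s>>%g]/(gval H).
have cardH : (#|{: 'M[F]_(m, n)}| %| #|H|)%N := card_dvdn_words B c hA hC hs.
move=> abGH idx nHG; split=> [defG N4 | defG]; rewrite defG in abGH idx nHG.
  have [N_ge5 | N_le4] := leqP 5 #|{: 'M[F]_(m, n)}|.
    have /simpleP[_ /(_ H nHG)[H1 | //]] := simple_Alt5 N_ge5.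
    by move: cardH; rewrite H1 cards1 dvdn1 => /eqP N1; rewrite N1 in M_gt1.
  (* For N <= 4 points, N divides the order of H, which times the index i of H
     is N! / 2; this excludes N = 2 and forces i = 1 for N = 3. For N = 4 it
     leaves i = 1 and i = 3, and i divides s. *)
  apply: index1g; first exact: normal_sub.
  have := card_Alt M_gt1; rewrite -(Lagrange (normal_sub nHG)).
  case/dvdnP: cardH => q ->; move: N4 M_gt1 N_le4 idx.
  set i := #|_ : _|%g; case: #|_| => [|[|[|[|[|N]]]]] //= N4 _ _ idx.
  - rewrite (_ : 2`! = 2%N) //; nia.
  - rewrite (_ : 3`! = 6%N) // => qi.
    by apply/eqP; rewrite -dvdn1; apply/dvdnP; exists q; nia.
  rewrite (_ : 4`! = 24%N) // => qi; have {qi} qi3 : (3 = q * i)%N by nia.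
  have /primeP[_ /(_ i)] : prime 3 by [].
  rewrite {1}qi3 dvdn_mull // => /(_ isT)/orP[/eqP // | /eqP i3].
  by have := N4 erefl; rewrite -i3 idx.
have sAltH : ('Alt_('M[F]_(m, n)))%g \subset H.
  apply: subset_trans (Alt_sub_der1_Sym _) _.
  by apply: der1_min abGH; exact: normal_norm.
split=> [even_s N2 | odd_s].
  apply/eqP; rewrite eqEsubset sAltH andbT; apply: words_even => // k.
  apply: (translation_even hp cardM N2); apply/matrixP => i j.
  by rewrite mulmxnE mxE mulrn_pchar // (card_finPcharP hF hp).
(* The index of H divides 2, because H contains the alternating group, and the
   odd number s. *)
apply: index1g; first exact: normal_sub.
have idx2 : (#|'Sym_('M[F]_(m, n))%g : H|%g %| 2)%N.
  by rewrite -(Alt_index M_gt1) indexgS.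
apply/eqP; rewrite -dvdn1 -(_ : gcdn 2 s = 1%N) ?dvdn_gcd ?idx2 //.
by apply/eqP; rewrite -[_ == _]/(coprime 2 s) coprime2n.
Qed.
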